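(* Suppose $(f,c,\mathcal{X})$ is regular problem data and $\mathcal{A}$ is a constraint dissolving mapping for it. Let $\beta\ge0$. Then $x\in\mathcal{K}$ satisfies strict complementarity for (NCP) if and only if it satisfies strict complementarity for (CDP).
   Context: **Problem.** $\mathcal{X}\subseteq\mathbb{R}^n$ is a closed convex set, $f:\mathbb{R}^n\to\mathbb{R}$, and $c:\mathcal{Y}\to\mathbb{R}^p$ where $\mathcal{Y}\subseteq\mathbb{R}^n$ is an open set containing $\mathcal{X}$. (NCP) is the problem $\min f(x)$ subject to $c(x)=0$, $x\in\mathcal{X}$, and $\mathcal{K}:=\{x\in\mathcal{X}: c(x)=0\}$. **Notation.** $\mathcal{T}_{\mathcal{X}}(x)$, $\mathcal{N}_{\mathcal{X}}(x)$ are the tangent and normal cones of $\mathcal{X}$ at $x$; $\mathrm{ri}$ is the relative interior; $\mathrm{aff}(\mathcal{X})$ is the affine hull; $\mathcal{E}:=\mathrm{aff}(\mathcal{X})-x$ (any $x\in\mathcal{X}$) is the associated linear subspace. $\nabla c(x)=[\nabla c_1(x),\dots,\nabla c_p(x)]\in\mathbb{R}^{n\times p}$ and $\nabla\mathcal{A}(x)=[\nabla\mathcal{A}_1(x),\dots,\nabla\mathcal{A}_n(x)]\in\mathbb{R}^{n\times n}$ are transposed Jacobians (the derivative of $\mathcal{A}$ on $\mathcal{X}$ being understood through an extension to a neighborhood of $\mathcal{X}$). $\mathrm{range}$ of a matrix is its column space. **Regular problem data.** $f$ is continuously differentiable with locally Lipschitz gradient on $\mathbb{R}^n$; $c$ is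 continuously differentiable with locally Lipschitz Jacobian on $\mathcal{Y}$; and there is $r>0$, independent of $x$, such that for every $x\in\mathcal{K}$ there is $\tau_x>0$ with: (a) $\dim\{\nabla c(y)^\top d: d\in\mathcal{E}\}=r$ for all $y\in\mathcal{Y}\cap\mathrm{aff}(\mathcal{X})$ with $\|y-x\|\le\tau_x$; (b) $\dim\{\nabla c(y)^\top d: d\in\mathcal{T}_{\mathcal{X}}(y)\cap-\mathcal{T}_{\mathcal{X}}(y)\}=r$ for all $y\in\mathcal{X}$ with $\|y-x\|\le\tau_x$. **Constraint dissolving mapping.** A mapping $\mathcal{A}:\mathcal{X}\to\mathbb{R}^n$ such that: (1) $\mathcal{A}$ is locally Lipschitz smooth (continuously differentiable with locally Lipschitz derivative) over $\mathcal{X}$; (2) $\mathcal{A}(x)=x$ and $\nabla\mathcal{A}(x)\nabla c(x)=0$ for all $x\in\mathcal{K}$; (3) there is a locally Lipschitz mapping $\mathcal{R}_{\mathcal{A}}:\mathcal{X}\to\mathbb{R}^{n\times n}$ with $\mathcal{R}_{\mathcal{A}}(x)=0$ for $x\in\mathcal{K}$, and for each $x\in\mathcal{K}$ there is $\omega_x>0$ such that $(\nabla\mathcal{A}(y)-I_n-\mathcal{R}_{\mathcal{A}}(y))v=0$ for all $y\in\mathcal{X}$ with $\|y-x\|\le\omega_x$ and all $v\in\mathcal{N}_{\mathcal{X}}(y)$. **(CDP).** $\min_{x\in\mathcal{X}} h(x):=f(\mathcal{A}(x))+\frac{\beta}{2}\|c(x)\|^2$, $\beta\ge0$; $\nabla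 h(x)=\nabla\mathcal{A}(x)\nabla f(\mathcal{A}(x))+\beta\nabla c(x)c(x)$, where $\nabla f(\mathcal{A}(x))$ means $\nabla f$ evaluated at $\mathcal{A}(x)$. **Strict complementarity.** $x\in\mathcal{K}$ satisfies strict complementarity for (NCP) if $0\in\nabla f(x)+\mathrm{range}(\nabla c(x))+\mathrm{ri}(\mathcal{N}_{\mathcal{X}}(x))$. $x\in\mathcal{X}$ satisfies strict complementarity for (CDP) if $0\in\nabla h(x)+\mathrm{ri}(\mathcal{N}_{\mathcal{X}}(x))$. *)

(* Defs.v *)
From HB Require Import structures.
From mathcomp Require Import all_boot all_order all_algebra.
From mathcomp Require Import all_classical all_reals all_analysis.

Set Implicit Arguments.
Unset Strict Implicit.
Unset Printing Implicit Defensive.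

Import Order.TTheory GRing.Theory Num.Theory.
Import numFieldNormedType.Exports.

Local Open Scope classical_set_scope.
Local Open Scope ring_scope.

(* Points and directions of R^n are row vectors, while gradients and normal
   vectors are column vectors.  With this convention the library's Jacobian
   ['J F x : 'M_(n, p)] of [F : 'rV_n -> 'rV_p], which acts on rows by
   ['d F x d = d *m 'J F x], has entries [d F_j / d x_i]: it is the transposed
   Jacobian, written nabla F(x) = [nabla F_1(x), ..., nabla F_p(x)] in the
   mathematics, and nabla F(x)^T d is the row [d *m 'J F x].
   Maps defined on a subset of R^n only are total functions constrained on that
   subset. *)

(* The library norm of 'rV_n is the sup norm. *)
Definition enorm (R : realType) (n : nat) (v : 'rV[R]_n) : R :=
  Num.sqrt (\sum_i v 0 i ^+ 2).

Definition gradient (R : realType) (n : nat) (f : 'rV[R]_n -> R)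
    (x : 'rV[R]_n) : 'cV[R]_n :=
  \col_i 'd f x (delta_mx 0 i).

Section convex_analysis.
Variable R : realType.

Definition aff (V : lmodType R) (S : set V) : set V :=
  [set z | exists (m : nat) (a : 'I_m -> R) (s : 'I_m -> V),
    [/\ forall i, S (s i), \sum_i a i = 1 & z = \sum_i a i *: s i]].

Definition aff_dir (V : lmodType R) (S : set V) : set V :=
  [set d | exists2 x, S x & aff S (x + d)].

Definition ri (V : normedModType R) (S : set V) : set V :=
  [set z | S z /\ \forall y \near z, aff S y -> S y].

Definition tangent_cone (V : normedModType R) (S : set V) (x : V) : set V :=
  [set d | exists (u : V^nat) (t : R^nat),
    [/\ forall k, S (u k), forall k, 0 < t k, t @ \oo --> 0,
        u @ \oo --> x & (fun k => (t k)^-1 *: (u k - x)) @ \oo --> d]].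

Definition normal_cone (n : nat) (S : set 'rV[R]_n) (x : 'rV[R]_n) :
    set 'cV[R]_n :=
  [set v | forall y, S y -> ((y - x) *m v) 0 0 <= 0].

Definition has_dim (V : vectType R) (S : set V) (r : nat) : Prop :=
  exists2 W : {vspace V}, S = [set d | d \in W] & \dim W = r.

End convex_analysis.

(* [F] is continuously differentiable on the (open) set [U], with derivative
   given by [DF], and [DF] is locally Lipschitz on [D].  The local Lipschitz
   property is the library's, which requires a Lipschitz bound on
   [D `*` D] near every point of [D `*` D]; near off-diagonal points it only
   adds local boundedness, which the diagonal points already give. *)
Definition lip_smooth (R : realType) (n p q : nat) (W : normedModType R)
    (U D : set 'rV[R]_n) (F : 'rV[R]_n -> W) (DF : 'rV[R]_n -> 'M[R]_(p, q)) :
    Prop :=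
  [/\ forall x, U x -> differentiable F x,
      forall x, U x -> {for x, continuous DF} &
      [locally [lipschitz DF x | x in D]]].

Section problem.
Variables (R : realType) (n p : nat).
Implicit Types (X Y : set 'rV[R]_n) (f : 'rV[R]_n -> R)
  (c : 'rV[R]_n -> 'rV[R]_p) (A : 'rV[R]_n -> 'rV[R]_n).

Definition feasible X c : set 'rV[R]_n := [set x | X x /\ c x = 0].

Definition regular_data X Y f c : Prop :=
  [/\ lip_smooth setT setT f (gradient f),
      lip_smooth Y Y c (jacobian c) &
      exists2 r : nat, (0 < r)%N &
        forall x, feasible X c x -> exists2 tau : R, 0 < tau &
          (forall y, Y y -> aff X y -> enorm (y - x) <= tau ->
            has_dim [set d *m 'J c y | d in aff_dir X] r) /\
          (forall y, X y -> enorm (y - x) <= tau ->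
            has_dim [set d *m 'J c y | d in
              [set d | tangent_cone X y d /\ tangent_cone X y (- d)]] r)].

(* The values of [A] on a neighborhood [U] of [X] play the role of the extension
   through which the derivative of [A] on [X] is defined. *)
Definition constraint_dissolving X c A : Prop :=
  [/\ exists U : set 'rV[R]_n,
        [/\ open U, X `<=` U & lip_smooth U X A (jacobian A)],
      forall x, feasible X c x -> A x = x /\ 'J A x *m 'J c x = 0 &
      exists RA : 'rV[R]_n -> 'M[R]_n,
        [/\ [locally [lipschitz RA x | x in X]],
            forall x, feasible X c x -> RA x = 0 &
            forall x, feasible X c x -> exists2 omega : R, 0 < omega &
              forall y, X y -> enorm (y - x) <= omega ->
                forall v, normal_cone X y v ->
                  ('J A y - 1%:M - RA y) *m v = 0]].

Definition cdp_obj f c A (beta : R) (x : 'rV[R]_n) : R :=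
  f (A x) + beta / 2 * enorm (c x) ^+ 2.

Definition sc_ncp X f c (x : 'rV[R]_n) : Prop :=
  exists2 u, range (mulmx ('J c x)) u &
  exists2 v : 'cV[R]_n, ri (normal_cone X x) v & 0 = gradient f x + u + v.

Definition sc_cdp X f c A (beta : R) (x : 'rV[R]_n) : Prop :=
  exists2 v : 'cV[R]_n, ri (normal_cone X x) v &
    0 = gradient (cdp_obj f c A beta) x + v.

End problem.

(* Main.v *)
Require Import Defs.
From mathcomp Require Import all_boot all_order all_algebra.
From mathcomp Require Import all_classical all_reals all_analysis.

From mathcomp Require Import ring lra.
From HB Require Import structures.

Import Order.TTheory GRing.Theory Num.Theory.
Import numFieldNormedType.Exports.

Local Open Scope classical_set_scope.
Local Open Scope ring_scope.

(** Write J and C for the transposed Jacobians of A and c at x, and g for the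
gradient of f at x.  Since A x = x and c x = 0, the chain rule gives J g for the
gradient of the dissolved objective, the penalty contributing nothing
([gradient_cdp_obj]).  Moreover J C = 0, and the third property of A, read at x
itself, says that J v = v for every normal vector v.

If 0 = g + C w + v with v in the relative interior of the normal cone, applying
J gives 0 = J g + v.  For the converse, 0 = J g + v means J (g + v) = 0 for the
given v, and g + v has to be shown to lie in the range of C.  Let E be the
direction space of aff X.  The crux is that d J = d for every d in E with
d C = 0 ([fixes_null_directions]).  Granting it, g + v is orthogonal to all such
d, hence g + v = C w + z with z orthogonal to E ([mulmx_preimage]).  Such a z is
normal to X at x, so z = J z = J (g + v) - J C w = 0.

The crux holds because A is the identity on the feasible set, so that J fixes
every direction tangent to that set ([fixed_points_tangent]); enough tangent
directions are needed.  Two facts supply them.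

First, by the constant rank assumption on aff X, the zero set of c within aff X
is near x a manifold whose tangent space at x is the null space of C in E
([constant_rank_tangent]).

Second, C has the same image on the lineality space of the tangent cone as on E.
Starting from a direction e that points into the relative interior of X, one can
therefore subtract a lineality vector with the same image under C; the result is
in the null space of C and still points into the relative interior of X
([interior_null_direction]).  Zeros of c that approach x along such a direction lie
in X, so they are feasible points.  As these directions
form a nonempty relatively open subset of the null space of C in E, they span
it. *)

(** * Norms and ranks of matrices *)

Lemma mx_entry_le_norm {R : realType} {m n : nat} (M : 'M[R]_(m, n)) i j :
  `|M i j| <= `|M|.
Proof.
by rewrite [leRHS]/Num.norm/= mx_normrE; apply: (le_bigmax _ _ (i, j)).
Qed.

Lemma mx_norm_le {R : realType} {m n : nat} (M : 'M[R]_(m, n)) (e : R) :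
  0 <= e -> (forall i j, `|M i j| <= e) -> `|M| <= e.
Proof.
move=> e0 Me; rewrite [leLHS]/Num.norm/= mx_normrE.
by apply: bigmax_le => // -[i j] _; exact: Me.
Qed.

Lemma norm_mulmx_le {R : realType} {m n k : nat}
    (M : 'M[R]_(m, n)) (N : 'M[R]_(n, k)) :
  `|M *m N| <= n%:R * (`|M| * `|N|).
Proof.
apply: mx_norm_le => [|i j]; first by rewrite !mulr_ge0.
rewrite mxE (le_trans (ler_norm_sum _ _ _))//.
rewrite mulr_natl -[X in _ *+ X]card_ord -sumr_const; apply: ler_sum => l _.
by rewrite normrM ler_pM// mx_entry_le_norm.
Qed.

Lemma enorm_le_norm {R : realType} {n : nat} (v : 'rV[R]_n) :
  enorm v <= n.+1%:R * `|v|.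
Proof.
have h0 : 0 <= n.+1%:R * `|v| by rewrite mulr_ge0.
rewrite /enorm -(ger0_norm h0) -sqrtr_sqr ler_sqrt ?sqr_ge0// exprMn.
apply: (@le_trans _ _ (n%:R * `|v| ^+ 2)).
  rewrite mulr_natl -[X in _ *+ X]card_ord -sumr_const; apply: ler_sum => i _.
  by rewrite -(real_normK (num_real (v 0 i))) ler_pXn2r ?nnegrE// mx_entry_le_norm.
rewrite ler_wpM2r ?sqr_ge0// -natrX ler_nat.
by rewrite -mulnn (leq_trans (leqnSn n))// leq_pmulr.
Qed.

(** The rows of 1 - B B^+, with B^+ a pseudo-inverse of B, annihilate B, hence k,
    so that k = B (B^+ k). *)
Lemma mulmx_preimage {F : fieldType} {m p q : nat}
    (B : 'M[F]_(m, p)) (k : 'M[F]_(m, q)) :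
  (forall a : 'rV_m, a *m B = 0 -> a *m k = 0) -> exists w, k = B *m w.
Proof.
move=> Bk; exists (pinvmx B *m k); apply/eqP; rewrite -subr_eq0.
rewrite mulmxA -{1}[k]mul1mx -mulmxBl; apply/eqP/row_matrixP => i.
rewrite row_mul row0 Bk// -row_mul mulmxBl mul1mx mulmxKpV// subrr.
exact: row0.
Qed.

(** A basis of the subspace, stacked into a matrix, is row free and has the same
    row space as B. *)
Lemma has_dim_rank {R : realType} {m p : nat} (S : set 'rV[R]_p) (r : nat)
    (B : 'M[R]_(m, p)) :
  has_dim S r -> (forall v, S v <-> (v <= B)%MS) -> \rank B = r.
Proof.
case=> W -> <- SB.
pose b := vbasis W.
pose D := \matrix_(i < \dim W) b`_i.
have combD (a : 'rV_(\dim W)) : a *m D = \sum_i a 0 i *: b`_i.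
  by rewrite mulmx_sum_row; apply: eq_bigr => i _; rewrite rowK.
have rD : row_free D.
  apply: inj_row_free => a; rewrite combD => a0; apply/rowP => i.
  by rewrite (freeP (basis_free (vbasisP W)) (fun i => a 0 i))// mxE.
rewrite -(eqP rD); apply/eqmx_rank/andP; split.
- apply/row_subP => i; have /SB /= iW := row_sub i B.
  rewrite (coord_vbasis iW).
  rewrite -[X in (X <= _)%MS](_ : (\row_j coord b j (row i B)) *m D = _).
    exact: submxMl.
  by rewrite combD; apply: eq_bigr => j _; rewrite mxE.
- apply/row_subP => i; apply/SB; rewrite /= rowK; apply: vbasis_mem.
  by rewrite mem_nth// size_tuple.
Qed.

Lemma has_dim_sub_eq {R : realType} {V : vectType R} (S T : set V) (r : nat) :
  has_dim S r -> has_dim T r -> S `<=` T -> T `<=` S.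
Proof.
case=> U -> <- [W -> WU] UW.
have /eqP -> // : U == W.
by rewrite eqEdim WU leqnn andbT; apply/subvP => v /UW.
Qed.

(** The fixed point theorem is stated on complete normed modules, so the complete
    and the normed structures of matrices are joined. *)
HB.instance Definition _ (R : realType) (m n : nat) :=
  Complete.on 'M[R]_(m, n).

(** * Calculus in several variables *)

(** Banach's theorem in the form of a self-map of a closed ball. *)
Lemma ball_fixed_point {R : realType} {V : completeNormedModType R}
    (f : V -> V) (rho q : R) :
  0 <= rho -> 0 <= q < 1 ->
  (forall w, `|w| <= rho -> `|f w| <= rho) ->
  (forall v w, `|v| <= rho -> `|w| <= rho -> `|f v - f w| <= q * `|v - w|) ->
  exists2 w, `|w| <= rho & f w = w.
Proof.
move=> rho0 /andP[q0 q1] fball fq.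
pose B : set V := [set w | `|w| <= rho].
have fB : set_fun B B f by move=> w; exact: fball.
pose mf := isFun.Build _ _ B B f fB.
pose F : {fun B >-> B} := HB.pack f mf.
have [|||w Bw wE] := @banach_fixed_point R V B F.
- exists (NngNum q0); split => // -[v w] /= [Bv Bw].
  exact: fq.
- rewrite -[B]/((fun w : V => `|w|) @^-1` [set t | t <= rho]).
  apply: (@preimage_closed _ _ (fun w : V => `|w|) [set t | t <= rho]).
    by move=> w _; exact: norm_continuous.
  exact: (@closed_le R rho).
- by exists 0; rewrite /B /= normr0.
by exists w => //; rewrite [RHS]wE.
Qed.

(** Cut [0, T] into N pieces: the increments add up to at most K T^2 / N. *)
Lemma quadratic_increment_cst {R : realType} {V : normedModType R}
    (h : R -> V) (K T : R) :
  0 <= T ->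
  (forall s t, 0 <= s -> s <= t -> t <= T ->
    `|h t - h s| <= K * (t - s) ^+ 2) ->
  h T = h 0.
Proof.
move=> T0 hK; apply/eqP; rewrite -subr_eq0 -normr_eq0 eq_le normr_ge0 andbT.
have bnd N : `|h T - h 0| <= K * T ^+ 2 / N.+1%:R.
  pose u i := h (T * (i%:R / N.+1%:R)).
  have -> : h T - h 0 = \sum_(0 <= i < N.+1) (u i.+1 - u i).
    by rewrite telescope_sumr// /u divff// mul0r mulr0 mulr1.
  rewrite (le_trans (ler_norm_sum _ _ _))//.
  have -> : K * T ^+ 2 / N.+1%:R = \sum_(0 <= i < N.+1) (K * (T / N.+1%:R) ^+ 2).
    by rewrite sumr_const_nat subn0 -mulr_natr; field.
  rewrite !big_nat; apply: ler_sum => i /andP[_ iN].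
  have step : T * (i.+1%:R / N.+1%:R) - T * (i%:R / N.+1%:R) = T / N.+1%:R.
    by rewrite -natr1; field.
  rewrite -step; apply: hK.
  + by rewrite mulr_ge0// divr_ge0.
  + by rewrite -subr_ge0 step divr_ge0.
  + by rewrite ler_piMr// ler_pdivrMr// mul1r ler_nat.
apply/ler_addgt0Pl => e e0; rewrite addr0.
have [N NE] : exists N : nat, `|K * T ^+ 2| / e < N.+1%:R.
  exists (Num.truncn (`|K * T ^+ 2| / e)).
  by rewrite truncnS_gt.
rewrite (le_trans (bnd N))// ler_pdivrMr// (le_trans (ler_norm _))//.
by rewrite [e * _]mulrC -ler_pdivrMr// ltW.
Qed.

(** The point s depends on the coordinate j, since the mean value theorem only
    applies to the scalar functions t |-> F (y + t (z - y)) 0 j. *)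
Lemma jacobian_mean_value {R : realType} {n p : nat} (F : 'rV[R]_n -> 'rV[R]_p)
    (y z : 'rV[R]_n) (j : 'I_p) :
  (forall s : R, 0 <= s <= 1 -> differentiable F (y + s *: (z - y))) ->
  exists2 s : R, 0 <= s <= 1 &
    (F z - F y) 0 j = ((z - y) *m 'J F (y + s *: (z - y))) 0 j.
Proof.
move=> dF; set v := z - y.
pose phi (s : R) : R := F (y + s *: v) 0 j.
pose dphi (s : R) : R := (v *m 'J F (y + s *: v)) 0 j.
have dphiP (s : R) : 0 <= s <= 1 -> is_derive s (1 : R) phi (dphi s).
  move=> s01; pose line (t : R) := F (y + t *: v).
  (* Both difference quotients, along the line and of F in the direction v, are the
     same function. *)
  have quotE : (fun h : R => h^-1 *: (line (h *: (1 : R) + s) - line s)) =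
      (fun h : R => h^-1 *: (F (h *: v + (y + s *: v)) - F (y + s *: v))).
    apply/funext => h; rewrite /line [_ *: 1]mulr1 scalerDl.
    by rewrite addrCA.
  have dl : derivable line s 1.
    by rewrite /derivable quotE; apply: diff_derivable; exact: dF.
  have Dl : 'D_1 line s = v *m 'J F (y + s *: v).
    by rewrite -deriveEjacobian; [rewrite /derive quotE|exact: dF].
  apply: DeriveDef; first exact: (derivable_mxP _ _ _).1 dl _ _.
  by rewrite /dphi -Dl (derive_mx dl) mxE.
have [s| |] := @MVT_segment R phi dphi 0 1 ler01.
- by rewrite in_itv/= => /andP[s0 s1]; apply: dphiP; rewrite !ltW.
- apply: derivable_within_continuous => s; rewrite in_itv/= => /dphiP H.
  exact: (@ex_derive _ _ _ _ _ _ _ H).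
move=> s; rewrite in_itv/= => s01; rewrite subr0 mulr1 => E; exists s => //.
by rewrite -/(dphi s) -E /phi scale0r addr0 scale1r /v [y + _]addrC subrK !mxE.
Qed.

Lemma jacobian_increment_le {R : realType} {n p : nat}
    (F : 'rV[R]_n -> 'rV[R]_p) (B : 'M[R]_(n, p)) (y z : 'rV[R]_n) (e : R) :
  (forall s : R, 0 <= s <= 1 -> differentiable F (y + s *: (z - y))) ->
  (forall s : R, 0 <= s <= 1 -> `|'J F (y + s *: (z - y)) - B| <= e) ->
  `|F z - F y - (z - y) *m B| <= n%:R * (`|z - y| * e).
Proof.
move=> dF JB.
have e0 : 0 <= e by apply: le_trans (JB 0 _); rewrite ?lexx ?ler01.
apply: mx_norm_le => [|i j]; first by rewrite !mulr_ge0.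
have [s s01 E] := jacobian_mean_value F y z j dF.
rewrite (ord1 i) mxE E [X in _ + X]mxE.
rewrite -[X in `|X|](_ : ((z - y) *m ('J F (y + s *: (z - y)) - B)) 0 j = _).
  rewrite (le_trans (mx_entry_le_norm _ _ _))// (le_trans (norm_mulmx_le _ _))//.
  by rewrite !ler_wpM2l// JB.
by rewrite mulmxBr !mxE.
Qed.

(** Near x the local Lipschitz condition gives one constant, valid for all pairs
    of points in a ball. *)
Lemma lip_smooth_ball {R : realType} {n p : nat} {Y : set 'rV[R]_n}
    {c : 'rV[R]_n -> 'rV[R]_p} (x : 'rV[R]_n) :
  open Y -> Y x -> lip_smooth Y Y c (jacobian c) ->
  exists delta L : R, [/\ 0 < delta, 0 < L,
    forall y, `|y - x| <= delta -> differentiable c y /\ Y y &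
    forall y z, `|y - x| <= delta -> `|z - x| <= delta ->
      `|'J c y - 'J c z| <= L * `|y - z|].
Proof.
move=> Yo Yx [dc _ lc].
have [L L0 /nbhs_ballP[d1 /= d10 Hd1]] := pinfty_ex_gt0 (lc (x, x) (conj Yx Yx)).
have /nbhs_ballP[d2 /= d20 Hd2] := open_nbhs_nbhs (conj Yo Yx).
have m0 : 0 < Num.min d1 d2 by rewrite lt_min d10 d20.
have YB y : `|y - x| <= Num.min d1 d2 / 2 -> ball x d1 y /\ Y y.
  move=> yx; have : `|x - y| < Num.min d1 d2.
    by rewrite distrC (le_lt_trans yx)// ltr_pdivrMr// ltr_pMr// ltr1n.
  rewrite lt_min => /andP[xy1 xy2].
  by split; [rewrite -ball_normE|apply: Hd2; rewrite -ball_normE].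
exists (Num.min d1 d2 / 2), L; split => //; first by rewrite divr_gt0.
  by move=> y /YB[_ Yy]; split => //; exact: dc.
move=> y z /YB[yB Yy] /YB[zB Yz].
exact: (Hd1 (y, z) (conj yB zB) (conj Yy Yz)).
Qed.

(** * Linear algebra of constant rank maps *)

(** Selects r = rank (E C) directions M in E on which C is injective with the same
    image as on E, together with a left inverse Q of M C.  The square system
    c y Q = 0 then stands for c y = 0, and M parametrizes the unknown. *)
Lemma reduced_basis {F : fieldType} {m n p : nat}
    (E : 'M[F]_(m, n)) (C : 'M[F]_(n, p)) :
  exists (M : 'M[F]_(\rank (E *m C), n)) (Q : 'M[F]_(p, \rank (E *m C))),
    (M <= E)%MS /\ M *m C *m Q = 1%:M.
Proof.
have /submxP[K KE] : (row_base (E *m C) <= E *m C)%MS by rewrite eq_row_base.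
have /row_freeP[Q Q1] := row_base_free (E *m C).
exists (K *m E), Q; split; first exact: submxMl.
by rewrite -(mulmxA K E C) -KE.
Qed.

(** If M B Q is close to the identity then M B has rank r, so it has the same row
    space as E B.  A vector e B is thus k M B for some k, and k is controlled by
    k M B Q = e B Q because M B Q is nearly the identity. *)
Lemma norm_mulmx_rank_le {R : realType} {m n p r : nat} (E : 'M[R]_(m, n))
    (M : 'M[R]_(r, n)) (B : 'M[R]_(n, p)) (Q : 'M[R]_(p, r)) (e : 'rV[R]_n) :
  (M <= E)%MS -> \rank (E *m B) = r ->
  r%:R * `|1%:M - M *m B *m Q| <= 1 / 2 -> (e <= E)%MS ->
  `|e *m B| <= r%:R * (2 * `|M *m B|) * `|e *m B *m Q|.
Proof.
move=> ME rE near1 eE; set D := M *m B *m Q.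
have kD (k : 'rV_r) : `|k| <= 2 * `|k *m D|.
  have : `|k - k *m D| <= `|k| / 2.
    rewrite -{1}[k]mulmx1 -mulmxBr (le_trans (norm_mulmx_le _ _))//.
    by rewrite mulrCA ler_wpM2l// -[leRHS]mul1r.
  have := lerB_dist k (k *m D).
  lra.
have fD : row_free D.
  apply: inj_row_free => k kD0; apply/eqP; rewrite -normr_le0.
  by rewrite (le_trans (kD k))// kD0 normr0 mulr0.
have MBrank : \rank (M *m B) = r.
  apply/eqP; rewrite eqn_leq rank_leq_row -{1}(eqP fD).
  exact: mxrankM_maxl.
have /submxP[k kE] : (e *m B <= M *m B)%MS.
  rewrite (submx_trans (submxMr B eE))//.
  by rewrite -(geq_leqif (mxrank_leqif_sup (submxMr B ME))) MBrank rE.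
rewrite kE (le_trans (norm_mulmx_le _ _))//.
rewrite -[leRHS]mulrA ler_wpM2l// [leRHS]mulrAC ler_wpM2r//.
by rewrite -[k *m _ *m Q]mulmxA.
Qed.

(** One estimate for the map w |-> w - c (x + t d + w M) Q, whose fixed points
    solve the reduced system.  It yields the contraction property (t = s), the
    invariance of a ball (s = 0, v = 0), and the Lipschitz dependence of the fixed
    point on t.  The linear parts cancel because M C Q = 1 and d C = 0. *)
Lemma fibre_increment {R : realType} {n p r : nat} (c : 'rV[R]_n -> 'rV[R]_p)
    (C : 'M[R]_(n, p)) (M : 'M[R]_(r, n)) (Q : 'M[R]_(p, r)) (x d : 'rV[R]_n)
    (e s t : R) (v w : 'rV[R]_r) :
  M *m C *m Q = 1%:M -> d *m C = 0 -> 0 <= e ->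
  let y := x + t *: d + w *m M in let z := x + s *: d + v *m M in
  `|c y - c z - (y - z) *m C| <= e * `|y - z| ->
  `|(w - c y *m Q) - (v - c z *m Q)| <=
    p%:R * `|Q| * e * (`|t - s| * `|d| + r%:R * `|M| * `|w - v|).
Proof.
move=> MCQ dC e0 y z cyz.
have yzE : y - z = (t - s) *: d + (w - v) *m M.
  by rewrite /y /z mulmxBl scalerBl; apply/rowP => i; rewrite !mxE; ring.
have -> : (w - c y *m Q) - (v - c z *m Q) =
    - ((c y - c z - (y - z) *m C) *m Q).
  have CQ : (y - z) *m C *m Q = w - v.
    rewrite yzE mulmxDl -scalemxAl dC scaler0 add0r.
    by rewrite -!mulmxA (mulmxA M) MCQ mulmx1.
  by rewrite 2!mulmxBl CQ; apply/rowP => i; rewrite !mxE; ring.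
rewrite normrN (le_trans (norm_mulmx_le _ _))// -!mulrA ler_wpM2l//.
rewrite mulrC ler_wpM2l// (le_trans cyz)// ler_wpM2l//.
rewrite yzE (le_trans (ler_normD _ _))// normrZ lerD2l.
by rewrite (le_trans (norm_mulmx_le _ _))// ler_wpM2l// mulrC.
Qed.

(** Between two solutions of the reduced system, c changes only by a multiple of
    its linearization error: by the rank hypothesis the whole vector (z - y) B is
    dominated by (z - y) B Q, which is minus the error seen through Q. *)
Lemma constant_rank_increment {R : realType} {n p m r : nat}
    (c : 'rV[R]_n -> 'rV[R]_p) (E : 'M[R]_(m, n)) (M : 'M[R]_(r, n))
    (Q : 'M[R]_(p, r)) (y z : 'rV[R]_n) (B : 'M[R]_(n, p)) (a b : R) :
  (M <= E)%MS -> \rank (E *m B) = r ->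
  r%:R * `|1%:M - M *m B *m Q| <= 1 / 2 -> `|M *m B| <= b -> (z - y <= E)%MS ->
  `|c z - c y - (z - y) *m B| <= a ->
  c y *m Q = 0 -> c z *m Q = 0 ->
  `|c z - c y| <= (1 + r%:R * (2 * b) * (p%:R * `|Q|)) * a.
Proof.
move=> ME rE near1 Bb zyE cyz cyQ czQ.
set X := c z - c y - _ in cyz.
have eQ : (z - y) *m B *m Q = - (X *m Q).
  rewrite [X *m Q]mulmxBl [(c z - c y) *m Q]mulmxBl.
  by rewrite cyQ czQ subr0 sub0r opprK.
have -> : c z - c y = X + (z - y) *m B by rewrite subrK.
rewrite mulrDl mul1r (le_trans (ler_normD _ _))// lerD//.
rewrite (le_trans (norm_mulmx_rank_le E M B Q _ ME rE near1 zyE))//.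
rewrite -!mulrA ler_wpM2l// ler_wpM2l// ler_pM//.
rewrite eQ normrN (le_trans (norm_mulmx_le _ _))// ler_wpM2l//.
by rewrite mulrC ler_wpM2l.
Qed.

(** * Tangent directions of the zero set of a constant rank map *)

Lemma mulr_le_of_le_div {R : realType} (a k e : R) :
  0 <= k -> 0 <= e -> e <= a / (k + 1) -> k * e <= a.
Proof.
move=> k0 e0; rewrite ler_pdivlMr ?ltr_wpDl// => h; apply: le_trans h.
by rewrite mulrC ler_wpM2l// lerDl.
Qed.

Lemma segment_ball {R : realType} {V : normedModType R} (x y z : V) (e s : R) :
  `|y - x| <= e -> `|z - x| <= e -> 0 <= s <= 1 ->
  `|y + s *: (z - y) - x| <= e.
Proof.
move=> yx zx /andP[s0 s1].
have -> : y + s *: (z - y) - x = (1 - s) *: (y - x) + s *: (z - x).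
  rewrite addrAC scalerBl scale1r -[RHS]addrA; congr (_ + _).
  by rewrite [RHS]addrC -scalerBr opprB addrA subrK.
rewrite (le_trans (ler_normD _ _))// !normrZ (ger0_norm s0).
rewrite (@ger0_norm _ (1 - s)) ?subr_ge0//.
rewrite -[leRHS](_ : (1 - s) * e + s * e = _); last by ring.
by rewrite lerD// ler_wpM2l// subr_ge0.
Qed.

(** The tangent half of the constant rank theorem.  For small t >= 0, solve the
    reduced system c (x + t d + w M) Q = 0 for w = w t; the contraction
    estimate makes w Lipschitz in t with a constant as small as desired, so that
    (w t) M / t is smaller than eps.  By [constant_rank_increment] the
    increments of c along this curve are quadratic in those of t, so c is constant
    on it and vanishes. *)
Lemma constant_rank_tangent {R : realType} {n p m : nat}
    (c : 'rV[R]_n -> 'rV[R]_p) (E : 'M[R]_(m, n)) (x d : 'rV[R]_n)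
    (delta L eps : R) :
  0 < delta -> 0 < L -> 0 < eps ->
  (forall y, `|y - x| <= delta -> differentiable c y) ->
  (forall y z, `|y - x| <= delta -> `|z - x| <= delta ->
    `|'J c y - 'J c z| <= L * `|y - z|) ->
  (forall y, `|y - x| <= delta -> (y - x <= E)%MS ->
    \rank (E *m 'J c y) = \rank (E *m 'J c x)) ->
  c x = 0 -> (d <= E)%MS -> d *m 'J c x = 0 ->
  exists t b, [/\ 0 < t <= eps, `|b| <= eps, (b <= E)%MS &
    c (x + t *: (d + b)) = 0].
Proof.
move=> delta0 L0 eps0 dc Lc rk cx0 dE dC.
pose C := 'J c x; pose r := \rank (E *m C).
have [M [Q [ME MCQ]]] : exists (M : 'M[R]_(r, n)) (Q : 'M[R]_(p, r)),
    (M <= E)%MS /\ M *m C *m Q = 1%:M by exact: (reduced_basis E C).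
pose q := p%:R * `|Q|; pose mu := r%:R * `|M|.
have q0 : 0 <= q by rewrite mulr_ge0.
have mu0 : 0 <= mu by rewrite mulr_ge0.
have nd0 : 0 <= `|d| by [].
(* The linearization error e has to make the reduced map a contraction of ratio
   1 / 2, and the final perturbation of d smaller than eps. *)
pose e := Num.min (1 / 2 / (q * mu + 1)) (eps / (2 * (q * `|d| * mu) + 1)).
have e0 : 0 < e.
  by rewrite lt_min !divr_gt0// ?mulr_gt0// ltr_wpDl// !mulr_ge0.
have e_ctr : q * e * mu <= 1 / 2.
  rewrite mulrAC.
  by apply: mulr_le_of_le_div; rewrite ?mulr_ge0 ?ge_min ?lexx// ltW.
have e_eps : 2 * (q * e * `|d|) * mu <= eps.
  rewrite [X in X <= _](_ : _ = 2 * (q * `|d| * mu) * e); last by ring.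
  by apply: mulr_le_of_le_div; rewrite ?mulr_ge0// ?ge_min ?lexx ?orbT// ltW.
(* On the ball of radius del the linearization error is at most e, and M 'J c y Q
   is close enough to the identity for [norm_mulmx_rank_le]. *)
pose del := Num.min delta (Num.min (e / (n%:R * L + 1))
  (1 / 2 / (mu * n%:R * q * L + 1))).
have del0 : 0 < del.
  by rewrite !lt_min delta0 !divr_gt0// ?mulr_gt0// ltr_wpDl// !mulr_ge0// ltW.
have del_delta : del <= delta by rewrite ge_min lexx.
have del_e : n%:R * L * del <= e.
  by apply: mulr_le_of_le_div; rewrite ?mulr_ge0 ?ge_min ?lexx ?orbT// ltW.
have del_rk : mu * n%:R * q * L * del <= 1 / 2.
  by apply: mulr_le_of_le_div; rewrite ?mulr_ge0 ?ge_min ?lexx ?orbT// ltW.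
have xx : `|x - x| <= delta by rewrite subrr normr0 ltW.
have seg y z : `|y - x| <= del -> `|z - x| <= del -> forall s, 0 <= s <= 1 ->
    `|y + s *: (z - y) - x| <= del.
  by move=> yx zx s s01; exact: segment_ball.
have strict y z : `|y - x| <= del -> `|z - x| <= del ->
    `|c y - c z - (y - z) *m C| <= e * `|y - z|.
  move=> yx zx.
  apply: le_trans (_ : n%:R * (`|y - z| * (L * del)) <= _).
    apply: jacobian_increment_le => s s01.
      by apply: dc; rewrite (le_trans (seg _ _ zx yx s s01)).
    have sd := seg _ _ zx yx s s01.
    by rewrite (le_trans (Lc _ _ (le_trans sd del_delta) xx))// ler_pM2l.
  by rewrite mulrCA mulrC ler_wpM2r// mulrA.
have taylor y z : `|y - x| <= del -> `|z - x| <= del ->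
    `|c z - c y - (z - y) *m 'J c y| <= n%:R * L * `|z - y| ^+ 2.
  move=> yx zx.
  apply: le_trans (_ : n%:R * (`|z - y| * (L * `|z - y|)) <= _).
    apply: jacobian_increment_le => s s01.
      by apply: dc; rewrite (le_trans (seg _ _ yx zx s s01)).
    have sd := seg _ _ yx zx s s01.
    rewrite (le_trans (Lc _ _ (le_trans sd del_delta) (le_trans yx del_delta)))//.
    rewrite ler_pM2l// addrC addKr normrZ ler_piMl//.
    by case/andP: s01 => s0 s1; rewrite ger0_norm.
  by rewrite le_eqVlt; apply/orP; left; apply/eqP; ring.
pose G t w := x + t *: d + w *m M.
(* The bounds on the unknown w and on the parameter t keep x + t d + w M in the
   ball of radius del; the second bound on t makes the ball of radius rho stable. *)
pose rho := del / 2 / (mu + 1).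
have rho0 : 0 < rho by rewrite !divr_gt0// ltr_wpDl.
pose T := Num.min eps (Num.min (del / 2 / (`|d| + 1)) (rho / 2 / (q * e * `|d| + 1))).
have T0 : 0 < T.
  by rewrite !lt_min eps0 !divr_gt0// ?mulr_gt0// ltr_wpDl// !mulr_ge0// ltW.
have T_eps : T <= eps by rewrite ge_min lexx.
have T_del : T * `|d| <= del / 2.
  rewrite mulrC; apply: mulr_le_of_le_div => //; first exact: ltW.
  by rewrite !ge_min lexx !orbT.
have T_rho : q * e * (T * `|d|) <= rho / 2.
  rewrite [X in X <= _](_ : _ = q * e * `|d| * T); last by ring.
  by apply: mulr_le_of_le_div; rewrite ?mulr_ge0 ?ge_min ?lexx ?orbT// ltW.
have rho_del : mu * rho <= del / 2.
  by apply: mulr_le_of_le_div => //; exact: ltW.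
have Gball t w : 0 <= t <= T -> `|w| <= rho -> `|G t w - x| <= del.
  move=> /andP[t0 tT] wr; rewrite /G -(addrA x) [x + _]addrC addrK.
  rewrite (le_trans (ler_normD _ _))// normrZ (ger0_norm t0).
  have h1 := norm_mulmx_le w M.
  have h2 : t * `|d| <= T * `|d| by rewrite ler_wpM2r.
  have h3 : r%:R * (`|w| * `|M|) <= mu * rho.
    by rewrite /mu -mulrA ler_wpM2l// mulrC ler_wpM2l.
  lra.
pose Phi t w := w - c (G t w) *m Q.
have Phi_le s t v w : 0 <= s <= T -> 0 <= t <= T -> `|v| <= rho -> `|w| <= rho ->
    `|Phi t w - Phi s v| <= q * e * (`|t - s| * `|d| + mu * `|w - v|).
  move=> sT tT vr wr; apply: (@fibre_increment R n p r c C M Q x d) => //.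
    exact: ltW.
  by apply: strict; exact: Gball.
have Phi00 : Phi 0 0 = 0.
  by rewrite /Phi /G scale0r mul0mx !addr0 cx0 mul0mx subrr.
have zT : 0 <= (0 : R) <= T by rewrite lexx ltW.
have zr : `|0 : 'rV[R]_r| <= rho by rewrite normr0 ltW.
have [w wP] : {w : R -> 'rV[R]_r & forall t, 0 <= t <= T ->
    `|w t| <= rho /\ Phi t (w t) = w t}.
  apply: (@choice _ _ (fun t v => 0 <= t <= T -> `|v| <= rho /\ Phi t v = v)).
  move=> t; have [tT|] := boolP (0 <= t <= T); last by exists 0.
  have [||v vr|v v' vr v'r|v vr Pv] :=
      @ball_fixed_point R 'rV[R]_r (Phi t) rho (1 / 2).
  - exact: ltW.
  - lra.
  - have := Phi_le 0 t 0 v zT tT zr vr.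
    rewrite Phi00 !subr0 => /le_trans; apply.
    case/andP: tT => t0 tT; rewrite (ger0_norm t0).
    have h1 : q * e * mu * `|v| <= 1 / 2 * rho by rewrite ler_pM// !mulr_ge0// ltW.
    have h2 : q * e * (t * `|d|) <= q * e * (T * `|d|).
      by rewrite ler_wpM2l// ?ler_wpM2r// mulr_ge0// ltW.
    rewrite mulrDr; lra.
  - rewrite (le_trans (Phi_le t t v' v tT tT v'r vr))//.
    by rewrite subrr normr0 mul0r add0r mulrA ler_wpM2r.
  - by exists v.
have w_lip s t : 0 <= s <= T -> 0 <= t <= T ->
    `|w t - w s| <= 2 * (q * e * `|d|) * `|t - s|.
  move=> sT tT; have [ws Ps] := wP _ sT; have [wt Pt] := wP _ tT.
  have := Phi_le s t (w s) (w t) sT tT ws wt; rewrite Ps Pt.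
  have h1 : q * e * mu * `|w t - w s| <= 1 / 2 * `|w t - w s| by rewrite ler_wpM2r.
  rewrite mulrDr; lra.
have w0 : w 0 = 0.
  have [wr Pw] := wP _ zT; apply/eqP; rewrite -normr_eq0 eq_le normr_ge0 andbT.
  have := Phi_le 0 0 0 (w 0) zT zT zr wr; rewrite Pw Phi00 !subr0 normr0 mul0r add0r.
  have h1 : q * e * mu * `|w 0| <= 1 / 2 * `|w 0| by rewrite ler_wpM2r.
  lra.
pose Lam := `|d| + mu * (2 * (q * e * `|d|)).
pose bJ := n%:R * (`|M| * (`|C| + L * del)).
pose K := (1 + r%:R * (2 * bJ) * q) * (n%:R * L * Lam ^+ 2).
have ccst : c (G T (w T)) = c (G 0 (w 0)).
  apply: (@quadratic_increment_cst _ _ (fun t => c (G t (w t))) K T).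
    exact: ltW.
  move=> s t s0 st tT.
  have sT' : 0 <= s <= T by rewrite s0 (le_trans st).
  have tT' : 0 <= t <= T by rewrite tT (le_trans s0).
  have [ws Ps] := wP _ sT'; have [wt Pt] := wP _ tT'.
  have yB := Gball _ _ sT' ws; have zB := Gball _ _ tT' wt.
  set y := G s (w s) in yB *; set z := G t (w t) in zB *.
  have zyE : z - y = (t - s) *: d + (w t - w s) *m M.
    by rewrite /y /z /G mulmxBl scalerBl; apply/rowP => i; rewrite !mxE; ring.
  have GE t' v : (G t' v - x <= E)%MS.
    rewrite /G -(addrA x) [x + _]addrC addrK addmx_sub ?scalemx_sub//.
    by rewrite (submx_trans (submxMl _ _)).
  have zyn : `|z - y| <= Lam * (t - s).
    rewrite zyE (le_trans (ler_normD _ _))// normrZ ger0_norm ?subr_ge0//.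
    rewrite /Lam [leRHS]mulrDl [X in X + _ <= _]mulrC lerD2l.
    rewrite (le_trans (norm_mulmx_le _ _))//.
    have := w_lip s t sT' tT'; rewrite (ger0_norm (_ : 0 <= t - s)) ?subr_ge0// => h.
    by rewrite -[leRHS]mulrA [in leRHS]/mu -[leRHS]mulrA ler_wpM2l// mulrC ler_wpM2l.
  have JyC : `|'J c y - C| <= L * del.
    by rewrite (le_trans (Lc _ _ (le_trans yB del_delta) xx))// ler_pM2l.
  have -> : K * (t - s) ^+ 2 = (1 + r%:R * (2 * bJ) * (p%:R * `|Q|)) *
      (n%:R * L * (Lam * (t - s)) ^+ 2) by rewrite /K /q; ring.
  rewrite -/y -/z; apply: (@constant_rank_increment R n p m r c E M Q y z ('J c y)).
  - exact: ME.
  - by apply: rk (GE _ _); exact: le_trans yB del_delta.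
  - rewrite -MCQ -mulmxBl -mulmxBr.
    have h1 := norm_mulmx_le (M *m (C - 'J c y)) Q.
    have h2 := norm_mulmx_le M (C - 'J c y).
    have h3 : `|C - 'J c y| <= L * del by rewrite distrC.
    apply: le_trans del_rk.
    have -> : mu * n%:R * q * L * del =
        r%:R * (p%:R * (n%:R * (`|M| * (L * del)) * `|Q|)).
      by rewrite /mu /q; ring.
    rewrite ler_wpM2l// (le_trans h1)// ler_wpM2l// ler_wpM2r//.
    by rewrite (le_trans h2)// !ler_wpM2l.
  - rewrite (le_trans (norm_mulmx_le _ _))// !ler_wpM2l//.
    have -> : 'J c y = C + ('J c y - C) by rewrite addrC subrK.
    by rewrite (le_trans (ler_normD _ _))// lerD2l.
  - by rewrite zyE addmx_sub ?scalemx_sub// (submx_trans (submxMl _ _)).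
  - rewrite (le_trans (taylor _ _ yB zB))// ler_wpM2l ?mulr_ge0 ?(ltW L0)//.
    by rewrite ler_pXn2r// nnegrE// (le_trans _ zyn).
  - by move/eqP: Ps; rewrite /Phi -subr_eq0 addrC addKr oppr_eq0 => /eqP.
  - by move/eqP: Pt; rewrite /Phi -subr_eq0 addrC addKr oppr_eq0 => /eqP.
have TT : 0 <= T <= T by rewrite lexx ltW.
exists T, (T^-1 *: w T *m M); split.
- by rewrite T0.
- rewrite -scalemxAl normrZ gtr0_norm ?invr_gt0// ler_pdivrMl//.
  have := w_lip 0 T zT TT; rewrite w0 !subr0 (gtr0_norm T0) => h.
  have h1 := norm_mulmx_le (w T) M.
  have h2 : r%:R * (`|w T| * `|M|) <= mu * (2 * (q * e * `|d|) * T).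
    by rewrite /mu -mulrA ler_wpM2l// mulrC ler_wpM2l.
  have h3 : 2 * (q * e * `|d|) * mu * T <= eps * T by rewrite ler_pM2r.
  lra.
- by rewrite (submx_trans (submxMl _ _)).
- rewrite -scalemxAl scalerDr scalerA divff ?gt_eqF// scale1r addrA -/(G T (w T)).
  by rewrite ccst w0 /G scale0r mul0mx !addr0.
Qed.

(** * Convex combinations and the direction space of the affine hull *)

Lemma convex_segment {R : realType} {V : lmodType R} (X : set V) (y z : V) (s : R) :
  convex_set X -> X y -> X z -> 0 <= s <= 1 -> X (y + s *: (z - y)).
Proof.
move=> cX Xy Xz /andP[s0 s1].
have := cX z y (Itv01 s0 s1) (mem_set Xz) (mem_set Xy).
rewrite inE; congr (X _).
rewrite /conv/= scalerBl scale1r scalerBr.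
by rewrite addrCA.
Qed.

(** The bound on the coefficients makes each x + (m + 1) a_i v_i a point of X; the
    sum is the average of these m points and x. *)
Lemma convex_sum {R : realType} {V : lmodType R} (X : set V) (x : V) (m : nat)
    (v : 'I_m -> V) (a : 'I_m -> R) :
  convex_set X -> X x -> (forall i, X (x + v i)) ->
  (forall i, 0 <= a i <= m.+1%:R^-1) -> X (x + \sum_i a i *: v i).
Proof.
move=> cX Xx Xv abnd.
pose y i := x + (m.+1%:R * a i) *: v i.
have Xy i : X (y i).
  have := convex_segment X x (x + v i) (m.+1%:R * a i) cX Xx (Xv i).
  rewrite [x + v i]addrC addrK; apply.
  have /andP[a0 a1] := abnd i.
  by rewrite mulr_ge0//= mulrC -ler_pdivlMr// mul1r.
(* Induction on the number of points, starting from x alone, avoids dividing by a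
   total weight that might vanish. *)
have avg k (w : 'I_k -> V) : (forall i, X (w i)) ->
    X (k.+1%:R^-1 *: (x + \sum_i w i)).
  elim: k w => [|k IH] w Xw; first by rewrite big_ord0 addr0 invr1 scale1r.
  rewrite big_ord_recr/=; set S := \sum_(i < k) _.
  have := convex_segment X _ _ k.+2%:R^-1 cX
    (IH _ (fun i => Xw (widen_ord (leqnSn k) i))) (Xw ord_max).
  rewrite invr_ge0 ler0n invf_le1// ler1n => /(_ isT); congr (X _).
  rewrite -/S [x + (S + _)]addrA; set Z := x + S.
  rewrite scalerBr [RHS]scalerDr addrCA [RHS]addrC; congr (_ + _).
  rewrite scalerA -scalerBl; congr (_ *: _).
  by rewrite -[k.+2%:R]natr1; field; rewrite !nat1r natr1 !pnatr_eq0.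
have := avg m y Xy; congr (X _).
rewrite /y big_split/= sumr_const card_ord addrA -mulrS -[x *+ _]scaler_nat.
rewrite scalerDr scalerA mulVf// scale1r scaler_sumr; congr (_ + _).
by apply: eq_bigr => i _; rewrite scalerA mulKf.
Qed.

(** Take finitely many vectors y - x with y in X, arranged as the rows of E, of
    maximal rank: adjoining a further such vector cannot increase the rank. *)
Lemma direction_space {R : realType} {n : nat} (X : set 'rV[R]_n) (x : 'rV[R]_n) :
  X x -> exists m (E : 'M[R]_(m, n)), [/\ forall i, X (x + row i E),
    forall y, aff X y -> (y - x <= E)%MS &
    forall d, (d <= E)%MS -> aff X (x + d)].
Proof.
move=> Xx.
(* The ranks attained by families of vectors y - x with y in X. *)
pose P r := exists m (E : 'M[R]_(m, n)), (forall i, X (x + row i E)) /\ \rank E = r.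
have P0 : exists r, `[< P r >].
  exists 0%N; apply/asboolP; exists 0%N, 0; split; first by case.
  exact: mxrank0.
have Pn r : `[< P r >] -> (r <= n)%N.
  by move=> /asboolP[m [E [_ <-]]]; exact: rank_leq_col.
case: (ex_maxnP P0 Pn) => r /asboolP[m [E [EX rE]]] rmax.
have XE y : X y -> (y - x <= E)%MS.
  move=> Xy; apply: contraT => yE.
  have : (\rank (col_mx E (y - x)) <= \rank E)%N.
    rewrite rE; apply: rmax; apply/asboolP; exists (m + 1)%N, (col_mx E (y - x)).
    split=> // i; case: (split_ordP i) => j ->; first by rewrite rowKu.
    by rewrite rowKd row_id addrC subrK.
  have sE : (E <= col_mx E (y - x))%MS by rewrite -addsmxE addsmxSl.
  rewrite (geq_leqif (mxrank_leqif_sup sE)) => h.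
  by rewrite -(negbTE yE) (submx_trans _ h)// -addsmxE addsmxSr.
exists m, E; split => //.
- move=> y [k [a [s [Xs a1 ->]]]].
  rewrite -[x]scale1r -a1 scaler_suml -sumrB; apply: summx_sub => i _.
  by rewrite -scalerBr scalemx_sub// XE.
- move=> d /submxP[w ->]; exists m.+1.
  exists (fun i => if unlift ord0 i is Some j then w 0 j else 1 - \sum_j w 0 j).
  exists (fun i => if unlift ord0 i is Some j then x + row j E else x).
  split.
  + by move=> i; case: unliftP.
  + rewrite big_ord_recl unlift_none; under [X in _ + X = _]eq_bigr do rewrite liftK.
    by rewrite subrK.
  + rewrite big_ord_recl unlift_none.
    under [X in _ = _ + X]eq_bigr do rewrite liftK scalerDr.
    rewrite big_split/= -scaler_suml addrA -scalerDl subrK scale1r.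
    by rewrite mulmx_sum_row.
Qed.

Lemma aff_dirP {R : realType} {n m : nat} (X : set 'rV[R]_n) (x : 'rV[R]_n)
    (E : 'M[R]_(m, n)) :
  X x -> (forall y, aff X y -> (y - x <= E)%MS) ->
  (forall d, (d <= E)%MS -> aff X (x + d)) ->
  forall d, aff_dir X d <-> (d <= E)%MS.
Proof.
move=> Xx affE Eaff d; split=> [[y Xy /affE yd]|/Eaff]; last by exists x.
have /affE yE : aff X y.
  exists 1%N, (fun=> 1), (fun=> y); split => //; first by rewrite big_ord1.
  by rewrite big_ord1 scale1r.
have -> : d = (y + d - x) - (y - x) by rewrite opprB addrA subrK addrC addKr.
by rewrite addmx_sub// -scaleN1r scalemx_sub.
Qed.

(** * Directions pointing into the relative interior *)

(** The direction d points from x into the relative interior of X: one step t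
    serves for a whole neighbourhood of d in the row space of E, which stands for
    the direction space of aff X. *)
Definition interior_direction {R : realType} {m n : nat} (X : set 'rV[R]_n)
    (E : 'M[R]_(m, n)) (x d : 'rV[R]_n) : Prop :=
  exists delta t : R, [/\ 0 < delta, 0 < t &
    forall b, (b <= E)%MS -> `|b| <= delta -> X (x + t *: (d + b))].

(** The barycentre of x and the points x + row i E lies in the relative interior
    of their convex hull.  Halving the weights leaves room on both sides for the
    coefficients of a perturbation b, which depend linearly on b. *)
Lemma interior_direction_exists {R : realType} {m n : nat} (X : set 'rV[R]_n)
    (E : 'M[R]_(m, n)) (x : 'rV[R]_n) :
  convex_set X -> X x -> (forall i, X (x + row i E)) ->
  exists2 e, (e <= E)%MS & interior_direction X E x e.
Proof.
move=> cX Xx XE; pose h : R := m.+1%:R^-1 / 2.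
have h0 : 0 < h by rewrite divr_gt0// invr_gt0.
have hh : h + h = m.+1%:R^-1 by rewrite /h -splitr.
exists (const_mx h *m E); first exact: submxMl.
pose k := n%:R * `|pinvmx E|.
have k0 : 0 <= k by rewrite mulr_ge0.
exists (h / (k + 1)), 1; split=> //; first by rewrite divr_gt0// ltr_wpDl.
move=> b bE bd; rewrite scale1r -(mulmxKpV bE) -mulmxDl mulmx_sum_row.
apply: convex_sum => // i; rewrite !mxE.
have /ler_normlP[w1 w2] : `|(b *m pinvmx E) 0 i| <= h.
  rewrite (le_trans (mx_entry_le_norm _ _ _))//.
  rewrite (le_trans (norm_mulmx_le _ _))// mulrCA mulrC.
  exact: mulr_le_of_le_div.
rewrite mxE in w1 w2.
by apply/andP; split; rewrite -?hh; lra.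
Qed.

Lemma interior_direction_perturb {R : realType} {m n : nat} (X : set 'rV[R]_n)
    (E : 'M[R]_(m, n)) (x d b : 'rV[R]_n) :
  interior_direction X E x d -> (b <= E)%MS ->
  exists2 s : R, 0 < s & interior_direction X E x (d + s *: b).
Proof.
move=> [delta [t [delta0 t0 Xd]]] bE.
pose s := delta / 2 / (`|b| + 1).
have s0 : 0 < s by rewrite !divr_gt0// ltr_wpDl.
have sb : `|s *: b| <= delta / 2.
  by rewrite normrZ gtr0_norm// mulrC mulr_le_of_le_div// ltW.
exists s => //.
exists (delta / 2), t; split=> //; first by rewrite divr_gt0.
move=> v vE vd; rewrite -addrA; apply: Xd; first by rewrite addmx_sub ?scalemx_sub.
by rewrite (le_trans (ler_normD _ _))// [leRHS]splitr lerD.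
Qed.

Lemma interior_direction_segment {R : realType} {m n : nat} (X : set 'rV[R]_n)
    (E : 'M[R]_(m, n)) (x d : 'rV[R]_n) :
  convex_set X -> X x -> interior_direction X E x d ->
  exists2 delta : R, 0 < delta & forall t b, 0 <= t <= delta -> (b <= E)%MS ->
    `|b| <= delta -> X (x + t *: (d + b)).
Proof.
move=> cX Xx [delta [t0 [delta0 t00 Xd]]].
exists (Num.min delta t0); first by rewrite lt_min delta0.
move=> t b /andP[t_0]; rewrite !le_min => /andP[_ tt0] bE /andP[bd _].
have := convex_segment X _ _ (t / t0) cX Xx (Xd b bE bd).
rewrite [x + t0 *: _]addrC addrK scalerA divfK ?gt_eqF//; apply.
by rewrite divr_ge0 ?(ltW t00)//= ler_pdivrMr// mul1r.
Qed.

Lemma tangent_cone_approx {R : realType} {n : nat} (X : set 'rV[R]_n)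
    (x t : 'rV[R]_n) (e : R) :
  tangent_cone X x t -> 0 < e ->
  exists u s, [/\ X u, 0 < s & `|t - s^-1 *: (u - x)| <= e].
Proof.
move=> [u [s [Xu s0 _ _ /cvgrPdist_le/(_ e)]]] h e0.
have [N _ HN] := h e0.
by exists (u N), (s N); split => //; exact: HN (leqnn N).
Qed.

(** The quotients (u - x) / s lie in the row space of E, which is closed: the
    cokernel of E annihilates them, hence also their limits. *)
Lemma tangent_cone_sub {R : realType} {n m : nat} (X : set 'rV[R]_n)
    (E : 'M[R]_(m, n)) (x t : 'rV[R]_n) :
  (forall y, X y -> (y - x <= E)%MS) -> tangent_cone X x t -> (t <= E)%MS.
Proof.
move=> XE Tt; rewrite submxE -normr_le0; apply/ler_addgt0Pl => e e0.
pose k := n%:R * `|cokermx E|.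
have k0 : 0 <= k by rewrite mulr_ge0.
have k1 : 0 < k + 1 by rewrite ltr_wpDl.
have [u [s [Xu s0 us]]] := tangent_cone_approx X x t _ Tt (divr_gt0 e0 k1).
have /eqP uE : s^-1 *: (u - x) *m cokermx E == 0.
  by rewrite -submxE scalemx_sub// XE.
rewrite addr0 -[t *m _]subr0 -uE -mulmxBl (le_trans (norm_mulmx_le _ _))//.
by rewrite mulrCA mulrC; exact: mulr_le_of_le_div.
Qed.

(** Approximate t by (u - x) / s with u in X and put the error into the free
    perturbation of d: x + tau (d + b') is in X.  A convex combination of this
    point with u is x + sigma (d + t + b), with sigma = tau s / (tau + s). *)
Lemma interior_direction_add_tangent {R : realType} {m n : nat}
    (X : set 'rV[R]_n) (E : 'M[R]_(m, n)) (x d t : 'rV[R]_n) :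
  convex_set X -> (forall y, X y -> (y - x <= E)%MS) ->
  interior_direction X E x d -> tangent_cone X x t ->
  interior_direction X E x (d + t).
Proof.
move=> cX XE [delta [tau [delta0 tau0 Xd]]] Tt.
have tE := tangent_cone_sub X E x t XE Tt.
have d20 : 0 < delta / 2 by rewrite divr_gt0.
have [u [s [Xu s0 us]]] := tangent_cone_approx X x t _ Tt d20.
have ts0 : 0 < tau + s by rewrite addr_gt0.
exists (delta / 2), (tau * s / (tau + s)); split=> //.
  by rewrite divr_gt0// mulr_gt0.
move=> b bE bd; pose b' := b + (t - s^-1 *: (u - x)).
have b'E : (b' <= E)%MS.
  by rewrite !addmx_sub// -scaleN1r !scalemx_sub// XE.
have b'd : `|b'| <= delta.
  by rewrite (le_trans (ler_normD _ _))// [leRHS]splitr lerD.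
have := convex_segment X u _ (s / (tau + s)) cX Xu (Xd b' b'E b'd).
rewrite divr_ge0 ?(ltW s0) ?(ltW ts0)//= ler_pdivrMr// mul1r lerDr ltW// => /(_ isT).
congr (X _); apply/rowP => i; rewrite /b' !mxE; field.
by rewrite !gt_eqF.
Qed.

(** * Derivatives of the dissolving mapping and of the dissolved objective *)

Lemma diff_increment_le {R : realType} {n p : nat} (F : 'rV[R]_n -> 'rV[R]_p)
    (x : 'rV[R]_n) (e : R) :
  differentiable F x -> 0 < e -> exists2 delta : R, 0 < delta &
    forall h, `|h| <= delta -> `|F (x + h) - F x - h *m 'J F x| <= e * `|h|.
Proof.
move=> dF e0; have /eqaddoP/(_ e e0)/nbhs_ballP[r /= r0 rF] := diff_locally dF.
exists (r / 2); first by rewrite divr_gt0.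
move=> h hr; have : ball 0 r h.
  rewrite -ball_normE/= sub0r normrN (le_lt_trans hr)// ltr_pdivrMr//.
  by rewrite ltr_pMr// ltr1n.
rewrite -addrA -opprD /jacobian mul_rV_lin1 [x + h]addrC.
exact: rF.
Qed.

(** Along fixed points x + h with h of direction nearly d, the differential of A
    gives h = h J + o(h). *)
Lemma fixed_points_tangent {R : realType} {n : nat} (A : 'rV[R]_n -> 'rV[R]_n)
    (x d : 'rV[R]_n) :
  differentiable A x -> A x = x ->
  (forall eps : R, 0 < eps -> exists t b, [/\ 0 < t <= eps, `|b| <= eps &
    A (x + t *: (d + b)) = x + t *: (d + b)]) ->
  d *m 'J A x = d.
Proof.
move=> dA Ax fixA; set J := 'J A x.
apply/eqP; rewrite eq_sym -subr_eq0 -normr_le0; apply/ler_addgt0Pl => e e0.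
rewrite addr0; pose k := `|d| + 1 + n%:R * `|1%:M - J|.
have k0 : 0 <= k by rewrite !addr_ge0// mulr_ge0.
pose e1 := e / (k + 1).
have e10 : 0 < e1 by rewrite divr_gt0// ltr_wpDl.
have [delta delta0 Adel] := diff_increment_le A x e1 dA e10.
pose eps := Num.min (Num.min 1 e1) (delta / (`|d| + 1)).
have eps0 : 0 < eps by rewrite !lt_min ltr01 e10 divr_gt0// ltr_wpDl.
have [t [b [/andP[t0 teps] beps Afix]]] := fixA eps eps0.
have b1 : `|b| <= 1 by rewrite (le_trans beps)// !ge_min lexx.
have be : `|b| <= e1 by rewrite (le_trans beps)// !ge_min lexx orbT.
have db : `|d + b| <= `|d| + 1 by rewrite (le_trans (ler_normD _ _))// lerD2l.
have hd : `|t *: (d + b)| <= delta.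
  rewrite normrZ gtr0_norm// (le_trans (ler_pM _ _ teps db)) ?(ltW t0)//.
  by rewrite -ler_pdivlMr ?ltr_wpDl// ge_min lexx orbT.
have := Adel _ hd; rewrite Afix Ax [x + _]addrC addrK -/J.
rewrite -[X in X - _]mulmx1 -mulmxBr -scalemxAl normrZ [`|t *: _|]normrZ.
rewrite mulrCA ler_pM2l ?normr_gt0 ?gt_eqF// mulmxDl => h.
rewrite -{1}[d]mulmx1 -mulmxBr.
rewrite -[X in `|X|](addrK (b *m (1%:M - J))) (le_trans (ler_normB _ _))//.
have hb : `|b *m (1%:M - J)| <= e1 * (n%:R * `|1%:M - J|).
  rewrite (le_trans (norm_mulmx_le _ _))// [leRHS]mulrCA ler_wpM2l//.
  by rewrite ler_wpM2r.
rewrite (le_trans (lerD h hb))//.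
apply: le_trans (_ : k * e1 <= _); last exact: mulr_le_of_le_div (ltW e10) _.
rewrite /k mulrC mulrDl lerD//; first by rewrite ler_wpM2r// ltW.
by rewrite mulrC.
Qed.

Lemma is_diff_sum0 {R : realType} {V : normedModType R} {I : Type} (r : seq I)
    (P : pred I) (F : I -> V -> R) (x : V) :
  (forall i, is_diff x (F i) (0 : V -> R)) ->
  is_diff x (\sum_(i <- r | P i) F i) (0 : V -> R).
Proof.
move=> F0; elim/big_ind : _ => // [|f g df dg].
  exact: is_diff_cst.
by have := is_diffD df dg; rewrite addr0.
Qed.

(** The penalty is a sum of squares that all vanish at x, so its differential at x
    is zero. *)
Lemma gradient_cdp_obj {R : realType} {n p : nat} (f : 'rV[R]_n -> R)
    (c : 'rV[R]_n -> 'rV[R]_p) (A : 'rV[R]_n -> 'rV[R]_n) (beta : R)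
    (x : 'rV[R]_n) :
  differentiable f x -> differentiable c x -> differentiable A x ->
  A x = x -> c x = 0 ->
  gradient (cdp_obj f c A beta) x = 'J A x *m gradient f x.
Proof.
move=> df dc dA Ax cx.
have dfA : is_diff x (f \o A) ('d f x \o 'd A x).
  apply: is_diff_comp; first exact: differentiableP.
  by rewrite Ax; exact: differentiableP.
have dsq j : is_diff x ((fun y => c y 0 j) ^+ 2) (0 : 'rV[R]_n -> R).
  have dcj : is_diff x (fun y => c y 0 j) ('d (fun y => c y 0 j) x).
    apply: differentiableP.
    exact: (differentiable_comp dc (differentiable_coord (c x) 0 j)).
  by have := is_diffX 1 dcj; rewrite cx mxE expr1 mulr0 scale0r.
have dpen := @is_diff_sum0 R 'rV[R]_n 'I_p (index_enum 'I_p) predT _ x dsq.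
have -> : cdp_obj f c A beta =
    (f \o A) + (beta / 2) *: (\sum_j (fun y => c y 0 j) ^+ 2).
  apply/funext => y; rewrite /cdp_obj /enorm sqr_sqrtr; last first.
    by apply: sumr_ge0 => i _; exact: sqr_ge0.
  by rewrite fctE; congr (_ + _); rewrite fctE fct_sumE.
have := is_diffD dfA (is_diffZ (beta / 2) dpen).
move=> dh; apply/colP => i; rewrite /gradient mxE (@diff_val _ _ _ _ _ _ _ dh).
rewrite scaler0 addr0 /= [X in 'd f x X]row_sum_delta linear_sum mxE.
by apply: eq_bigr => j _; rewrite linearZ /= !mxE.
Qed.

(** * Null directions of the constraints *)

Lemma rank_image_direction {R : realType} {n p m : nat} (S : set 'rV[R]_n)
    (E : 'M[R]_(m, n)) (B : 'M[R]_(n, p)) (r : nat) :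
  (forall d, S d <-> (d <= E)%MS) -> has_dim [set d *m B | d in S] r ->
  \rank (E *m B) = r.
Proof.
move=> SE dimr; apply: (has_dim_rank _ _ _ dimr) => v; split=> [[d /SE dE <-]|].
  exact: submxMr.
move=> /submxP[w ->]; exists (w *m E); last by rewrite mulmxA.
by apply/SE; exact: submxMl.
Qed.

Lemma regular_constant_rank {R : realType} {n p m : nat} {X Y : set 'rV[R]_n}
    {f : 'rV[R]_n -> R} {c : 'rV[R]_n -> 'rV[R]_p} {x : 'rV[R]_n}
    (E : 'M[R]_(m, n)) :
  open Y -> X `<=` Y -> regular_data X Y f c -> feasible X c x ->
  (forall y, aff X y -> (y - x <= E)%MS) ->
  (forall d, (d <= E)%MS -> aff X (x + d)) ->
  exists2 delta : R, 0 < delta & forall y, `|y - x| <= delta ->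
    (y - x <= E)%MS -> \rank (E *m 'J c y) = \rank (E *m 'J c x).
Proof.
move=> Yo XY [_ _ [r _ reg]] Kx affE Eaff.
have [Xx _] := Kx; have dirE := aff_dirP X x E Xx affE Eaff.
have [tau tau0 [rkaff _]] := reg x Kx.
have /nbhs_ballP[d1 /= d10 Yd1] := open_nbhs_nbhs (conj Yo (XY _ Xx)).
have rk y : Y y -> (y - x <= E)%MS -> enorm (y - x) <= tau ->
    \rank (E *m 'J c y) = r.
  move=> Yy yE ytau; apply: (rank_image_direction _ _ _ _ dirE).
  by apply: rkaff => //; have := Eaff _ yE; rewrite addrC subrK.
have rkx : \rank (E *m 'J c x) = r.
  apply: rk; rewrite ?subrr ?sub0mx//; first exact: XY.
  by rewrite (le_trans (enorm_le_norm _))// normr0 mulr0 ltW.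
exists (Num.min (d1 / 2) (tau / n.+1%:R)).
  by rewrite lt_min !divr_gt0.
move=> y; rewrite le_min => /andP[yd1 ytau] yE.
apply: (etrans _ (esym rkx)); apply: rk => //; last first.
  by rewrite (le_trans (enorm_le_norm _))// mulrC -ler_pdivlMr.
apply: Yd1; rewrite -ball_normE/= distrC (le_lt_trans yd1)//.
by rewrite ltr_pdivrMr// ltr_pMr// ltr1n.
Qed.

(** By the two dimension conditions at x, the lineality space and the direction
    space of aff X have the same image under the Jacobian of c.  So some l in the
    lineality space has the same image as a given interior direction e, and e - l
    still points into the relative interior, as - l is tangent. *)
Lemma interior_null_direction {R : realType} {n p m : nat} {X Y : set 'rV[R]_n}
    {f : 'rV[R]_n -> R} {c : 'rV[R]_n -> 'rV[R]_p} {x : 'rV[R]_n}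
    (E : 'M[R]_(m, n)) :
  convex_set X -> X `<=` Y -> regular_data X Y f c -> feasible X c x ->
  (forall i, X (x + row i E)) ->
  (forall y, X y -> (y - x <= E)%MS) ->
  (forall d, aff_dir X d <-> (d <= E)%MS) ->
  exists d, [/\ (d <= E)%MS, d *m 'J c x = 0 & interior_direction X E x d].
Proof.
move=> cX XY [_ _ [r _ reg]] Kx EX XE dirE; have [Xx _] := Kx.
have [tau tau0 [rkaff rklin]] := reg x Kx.
have xtau : enorm (x - x) <= tau.
  rewrite subrr (le_trans (enorm_le_norm _))// normr0 mulr0; exact: ltW.
have [e eE inte] := interior_direction_exists X E x cX Xx EX.
have affx : aff X x.
  exists 1%N, (fun=> 1), (fun=> x); split => //; first by rewrite big_ord1.
  by rewrite big_ord1 scale1r.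
have [||l [Tl TNl] lC] := has_dim_sub_eq _ _ r (rklin x Xx xtau)
    (rkaff x (XY _ Xx) affx xtau) _ (e *m 'J c x) _.
- move=> _ [l [Tl _] <-]; exists l => //; apply/dirE.
  exact: tangent_cone_sub Tl.
- by exists e => //; apply/dirE.
exists (e - l); split.
- by rewrite addmx_sub// (tangent_cone_sub X _ x).
- by rewrite mulmxBl lC subrr.
- exact: interior_direction_add_tangent.
Qed.

(** For a direction v of the null space pointing into the relative interior, the
    zeros of c provided by the constant rank theorem lie in X, hence are fixed by
    A.  The general case follows by comparing two such directions, d0 and
    d0 + s d. *)
Lemma fixes_null_directions {R : realType} {n p m : nat} {X Y : set 'rV[R]_n}
    {f : 'rV[R]_n -> R} {c : 'rV[R]_n -> 'rV[R]_p} {A : 'rV[R]_n -> 'rV[R]_n}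
    {x : 'rV[R]_n} (E : 'M[R]_(m, n)) (d : 'rV[R]_n) :
  convex_set X -> open Y -> X `<=` Y -> regular_data X Y f c ->
  feasible X c x ->
  (forall i, X (x + row i E)) ->
  (forall y, aff X y -> (y - x <= E)%MS) ->
  (forall d, (d <= E)%MS -> aff X (x + d)) ->
  differentiable A x -> (forall y, feasible X c y -> A y = y) ->
  (d <= E)%MS -> d *m 'J c x = 0 -> d *m 'J A x = d.
Proof.
move=> cX Yo XY reg Kx EX affE Eaff dA Afix.
have [Xx cx] := Kx; have dirE := aff_dirP X x E Xx affE Eaff.
have XE y : X y -> (y - x <= E)%MS.
  move=> Xy; apply: affE; exists 1%N, (fun=> 1), (fun=> y).
  by split => //; rewrite big_ord1 ?scale1r.
have interior_fixed v : (v <= E)%MS -> v *m 'J c x = 0 ->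
    interior_direction X E x v -> v *m 'J A x = v.
  move=> vE vC intv.
  apply: fixed_points_tangent => //; first exact: Afix.
  move=> eps eps0.
  have [d1 d10 Xd1] := interior_direction_segment X E x v cX Xx intv.
  have [_ cY _] := reg.
  have [d2 [L [d20 L0 dc Lc]]] := lip_smooth_ball x Yo (XY _ Xx) cY.
  have [d3 d30 rk] := regular_constant_rank E Yo XY reg Kx affE Eaff.
  have [|||y|y z|y||||] := @constant_rank_tangent R n p m c E x v
      (Num.min d2 d3) L (Num.min eps d1).
  - by rewrite lt_min d20.
  - exact: L0.
  - by rewrite lt_min eps0.
  - by rewrite le_min => /andP[/dc[]].
  - by rewrite !le_min => /andP[y2 _] /andP[z2 _]; exact: Lc.
  - by rewrite le_min => /andP[_ /rk].
  - exact: cx.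
  - exact: vE.
  - exact: vC.
  move=> t [b []]; rewrite !le_min => /and3P[t0 te td] /andP[be bd] bE cb.
  exists t, b; rewrite t0 te; split => //.
  apply: Afix; split => //; apply: Xd1 => //.
  by rewrite (ltW t0).
have [d0 [d0E d0C int0]] := interior_null_direction E cX XY reg Kx EX XE dirE.
move=> dE dC; have [s s0 ints] := interior_direction_perturb X E x d0 d int0 dE.
have := interior_fixed (d0 + s *: d).
rewrite addmx_sub ?scalemx_sub// mulmxDl d0C -scalemxAl dC scaler0 addr0.
move=> /(_ isT erefl ints); rewrite mulmxDl interior_fixed// -scalemxAl.
by move/addrI/scalerI; apply; rewrite gt_eqF.
Qed.

Theorem theorem3p13 (R : realType) (n p : nat) (X Y : set 'rV[R]_n)
    (f : 'rV[R]_n -> R) (c : 'rV[R]_n -> 'rV[R]_p)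
    (A : 'rV[R]_n -> 'rV[R]_n) (beta : R)
    (X_closed : closed X) (X_convex : convex_set X)
    (Y_open : open Y) (XY : X `<=` Y)
    (reg : regular_data X Y f c)
    (cdm : constraint_dissolving X c A)
    (beta_ge0 : 0 <= beta)
    (x : 'rV[R]_n) (Kx : feasible X c x) :
  sc_ncp X f c x <-> sc_cdp X f c A beta x.
Proof.
have [Xx cx] := Kx; have [[df _ _] [dc _ _] _] := reg.
case: cdm => -[U [_ XU [dA _ _]]] AK [RA [_ RA0 RAN]].
have [Ax JAC] := AK x Kx.
have gradE := gradient_cdp_obj f c A beta x (df x I) (dc _ (XY _ Xx))
  (dA _ (XU _ Xx)) Ax cx.
have JN v : normal_cone X x v -> 'J A x *m v = v.
  move=> Nv; have [omega omega0 /(_ x Xx)] := RAN x Kx.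
  rewrite RA0// subrr subr0 => /(_ _ v Nv); rewrite mulmxBl mul1mx => h.
  apply/eqP; rewrite -subr_eq0 h// (le_trans (enorm_le_norm _))//.
  by rewrite normr0 mulr0 ltW.
rewrite /sc_cdp gradE.
split=> [[_ [w _ <-] [v riv E0]]|[v riv E0]].
  exists v => //; rewrite -[in RHS](JN v (proj1 riv)) -mulmxDr.
  have -> : gradient f x + v = - ('J c x *m w).
    by apply/eqP; rewrite -addr_eq0 addrAC -E0.
  by rewrite mulmxN mulmxA JAC mul0mx oppr0.
have [m [E [EX affE Eaff]]] := direction_space X x Xx.
(* u is orthogonal to the null directions a E, so E u lies in the range of E C. *)
set u := gradient f x + v.
have Ju : 'J A x *m u = 0 by rewrite mulmxDr (JN _ (proj1 riv)).
have [w kE] : exists w, E *m u = E *m 'J c x *m w.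
  apply: mulmx_preimage => a; rewrite mulmxA => aEC.
  have aEJ := fixes_null_directions E (a *m E) X_convex Y_open XY reg Kx EX affE
    Eaff (dA x (XU x Xx)) (fun y Ky => (AK y Ky).1) (submxMl a E) aEC.
  by rewrite mulmxA -aEJ -mulmxA Ju mulmx0.
have Nz : normal_cone X x (u - 'J c x *m w).
  move=> y Xy; have /submxP[a ->] : (y - x <= E)%MS.
    apply: affE; exists 1%N, (fun=> 1), (fun=> y).
    by split => //; rewrite big_ord1 ?scale1r.
  by rewrite -mulmxA mulmxBr kE -mulmxA subrr mulmx0 mxE.
exists ('J c x *m (- w)); first by exists (- w).
exists v => //; rewrite addrAC -/u mulmxN -(JN _ Nz).
by rewrite mulmxBr Ju mulmxA JAC mul0mx subrr.
Qed.
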